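(* Let $\{Y_k\}$ be a fourth-order stationary sequence with $EY_k=0$, autocovariances $\gamma_j=\mathrm{Cov}(Y_0,Y_j)$ and fourth-order cumulants $\kappa(h,r,s)$, satisfying: (a) $n^{-1/2}\sum_{1\le j\le nt}Y_j\xrightarrow{d}\sigma W(t)$ in $D[0,1]$ for some $\sigma>0$; (b) $\sum_j|\gamma_j|<\infty$; (c) $\sup_h\sum_{r,s}|\kappa(h,r,s)|<\infty$. For each $n$ let $X_i=\mu+Y_i$ for $1\le i\le k^*$ and $X_i=\mu+\Delta+Y_i$ for $k^*<i\le n$, where $\mu$ is a constant and $k^*=k^*(n)$, $\Delta=\Delta(n)$ satisfy $k^*=[n\theta]$ for some $0<\theta<1$, $n\Delta^2\to\infty$, $\Delta^2|\hat k-k^*|=O_P(1)$ and $q(n)\Delta^2=O(1)$. Suppose $q(n)\to\infty$ and $q(n)/n\to0$. Then $T_n\xrightarrow{P}\infty$.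
   Context: A sequence is fourth-order stationary if it has finite fourth moments and its joint moments of order at most four are shift invariant; $\kappa(h,r,s)=E[Y_kY_{k+h}Y_{k+r}Y_{k+s}]-(\gamma_h\gamma_{r-s}+\gamma_r\gamma_{h-s}+\gamma_s\gamma_{h-r})$. $q(n)$ is a sequence of positive integers, $\omega_j(q)=1-j/(q+1)$, $\bar X_n=\frac1n\sum_{i\le n}X_i$, $\hat\gamma_j=\frac1n\sum_{1\le i\le n-j}(X_i-\bar X_n)(X_{i+j}-\bar X_n)$, $s_n^2=\hat\gamma_0+2\sum_{1\le j\le q(n)}\omega_j(q(n))\hat\gamma_j$, $T_n=\frac1{n^{1/2}s_n}\max_{1\le k\le n}|\sum_{i\le k}X_i-\frac kn\sum_{i\le n}X_i|$, and $\hat k=\min\{k:\max_{1\le i\le n}|\sum_{j\le i}X_j-\frac in\sum_{j\le n}X_j|=|\sum_{j\le k}X_j-\frac kn\sum_{j\le n}X_j|\}$. *)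

(* Defs.v *)
From HB Require Import structures.
From mathcomp Require Import all_boot all_order all_algebra.
From mathcomp Require Import all_classical all_reals all_analysis.
Set Implicit Arguments. Unset Strict Implicit. Unset Printing Implicit Defensive.
Import Order.TTheory GRing.Theory Num.Theory.
Import numFieldNormedType.Exports.
Local Open Scope classical_set_scope.
Local Open Scope ring_scope.

Section Defs.
Context {R : realType}.

Definition Ex {d} {T : measurableType d} (P : probability T R) (f : T -> R) : \bar R :=
  (\int[P]_w (f w)%:E)%E.

Definition fourth_order_stationary {d} {T : measurableType d}
    (P : probability T R) (Y : int -> T -> R) : Prop :=
  (forall k, measurable_fun setT (Y k)) /\
  (forall k, P.-integrable setT (fun w => (Y k w ^+ 4)%:E)) /\
  (forall (s : seq int) (k : int), (size s <= 4)%N ->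
     Ex P (fun w => \prod_(i <- s) Y (i + k) w) = Ex P (fun w => \prod_(i <- s) Y i w)).

Definition autocov {d} {T : measurableType d} (P : probability T R)
    (Y : int -> T -> R) (j : int) : R :=
  fine (Ex P (fun w => Y 0 w * Y j w)) - fine (Ex P (Y 0)) * fine (Ex P (Y j)).

(** kappa(h,r,s) (independent of k by stationarity; taken at k = 0) *)
Definition cum4 {d} {T : measurableType d} (P : probability T R)
    (Y : int -> T -> R) (h r s : int) : R :=
  fine (Ex P (fun w => Y 0 w * Y h w * Y r w * Y s w))
  - (autocov P Y h * autocov P Y (r - s) + autocov P Y r * autocov P Y (h - s)
     + autocov P Y s * autocov P Y (h - r)).

Definition abs_summable_Z (f : int -> R) : Prop :=
  exists C : R, forall N : nat, \sum_(i < (2 * N).+1) `|f (i%:Z - N%:Z)| <= C.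

Definition cum4_summable {d} {T : measurableType d} (P : probability T R)
    (Y : int -> T -> R) : Prop :=
  exists C : R, forall (h : int) (N : nat),
    \sum_(r < (2 * N).+1) \sum_(s < (2 * N).+1)
       `|cum4 P Y h (r%:Z - N%:Z) (s%:Z - N%:Z)| <= C.

(** D[0,1]: paths x : R -> R, only their restriction to [0,1] matters;
    cadlag on [0,1]. *)
Definition cadlag01 (x : R -> R) : Prop :=
  (forall t : R, 0 <= t -> t < 1 -> x @ t^'+ --> x t) /\
  (forall t : R, 0 < t -> t <= 1 -> cvg (x @ t^'-)).

Definition time_change01 (l : R -> R) : Prop :=
  {within `[0, 1]%classic, continuous l} /\ l 0 = 0 /\ l 1 = 1 /\
  (forall a b : R, 0 <= a -> a < b -> b <= 1 -> l a < l b).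

Definition skorokhod_lt (x y : R -> R) (e : R) : Prop :=
  exists l, time_change01 l /\ exists2 e', e' < e &
    forall t : R, 0 <= t -> t <= 1 -> `|l t - t| <= e' /\ `|x (l t) - y t| <= e'.

Definition skorokhod_continuous (f : (R -> R) -> R) : Prop :=
  forall x, cadlag01 x -> forall e : R, 0 < e ->
    exists2 dl : R, 0 < dl &
      forall y, cadlag01 y -> skorokhod_lt x y dl -> `|f x - f y| < e.

Definition bounded_functional (f : (R -> R) -> R) : Prop :=
  exists M : R, forall x, `|f x| <= M.

Definition std_brownian01 {d'} {T' : measurableType d'} (P' : probability T' R)
    (W : R -> T' -> R) : Prop :=
  (forall t, measurable_fun setT (W t)) /\
  (forall w, W 0 w = 0) /\
  (forall w, {within `[0, 1]%classic, continuous (fun t => W t w)}) /\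
  (forall (k : nat) (t : nat -> R) (A : nat -> set R),
     t 0%N = 0 -> (forall i, (i < k)%N -> t i < t i.+1) -> t k <= 1 ->
     (forall i, measurable (A i)) ->
     P' (\bigcap_(i in [set j | (j < k)%N]) [set w | A i (W (t i.+1) w - W (t i) w)])
     = (\prod_(i < k) normal_prob 0 (Num.sqrt (t i.+1 - t i)) (A i))%E).

Definition partial_sum_process {T : Type} (Y : int -> T -> R) (n : nat) (w : T) : R -> R :=
  fun t => (Num.sqrt n%:R)^-1 * \sum_(1 <= j < (Num.truncn (n%:R * t)).+1) Y j%:Z w.

Definition FCLT {d} {T : measurableType d} (P : probability T R)
    (Y : int -> T -> R) (sigma : R) : Prop :=
  exists (d' : measure_display) (T' : measurableType d') (P' : probability T' R)
         (W : R -> T' -> R),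
    std_brownian01 P' W /\
    forall f, bounded_functional f -> skorokhod_continuous f ->
      (fun n => Ex P (fun w => f (partial_sum_process Y n w))) @ \oo
        --> Ex P' (fun w => f (fun t => sigma * W t w)).

Definition kstar (theta : R) (n : nat) : nat := Num.truncn (n%:R * theta).

Definition Xobs {T : Type} (mu theta : R) (Delta : nat -> R) (Y : int -> T -> R)
    (n : nat) (w : T) (i : nat) : R :=
  mu + (if (i <= kstar theta n)%N then 0 else Delta n) + Y i%:Z w.

Definition Xbar (n : nat) (x : nat -> R) : R := n%:R^-1 * \sum_(1 <= i < n.+1) x i.

Definition gammahat (n : nat) (x : nat -> R) (j : nat) : R :=
  n%:R^-1 * \sum_(1 <= i < (n - j).+1) (x i - Xbar n x) * (x (i + j)%N - Xbar n x).

Definition bartlett (q j : nat) : R := 1 - j%:R / (q.+1)%:R.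

Definition s2 (n q : nat) (x : nat -> R) : R :=
  gammahat n x 0 + 2 * \sum_(1 <= j < q.+1) bartlett q j * gammahat n x j.

Definition cusum (n : nat) (x : nat -> R) (k : nat) : R :=
  \sum_(1 <= i < k.+1) x i - k%:R / n%:R * \sum_(1 <= i < n.+1) x i.

Definition cusum_max (n : nat) (x : nat -> R) : R :=
  \big[Num.max/0]_(1 <= i < n.+1) `|cusum n x i|.

Definition Tn (n q : nat) (x : nat -> R) : R :=
  (Num.sqrt n%:R * Num.sqrt (s2 n q x))^-1 * cusum_max n x.

Definition khat (n : nat) (x : nat -> R) : nat :=
  head 0%N [seq k <- iota 1 n | `|cusum n x k| == cusum_max n x].

End Defs.

(* Main.v *)
Require Import Defs.
From HB Require Import structures.
From mathcomp Require Import all_boot all_order all_algebra.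
From mathcomp Require Import all_classical all_reals all_analysis.
From mathcomp Require Import measurable_realfun.
From mathcomp Require Import ring lra zify.
Import Order.TTheory GRing.Theory Num.Theory.
Import numFieldNormedType.Exports.
Local Open Scope classical_set_scope.
Local Open Scope ring_scope.

(** The Bartlett estimator is a quadratic form: with z the centred
    observations, padded by zeros outside 1..n, s_n^2 is 1/(n(q+1)) times the
    sum over all windows of length q+1 of the squared window sums of z. Hence
    s_n^2 >= 0, and s_n = 0 forces z = 0. By the Schur test, summability of the
    autocovariances bounds the second moment of a linear form in Y by a constant
    times the sum of its squared coefficients. So E s_n^2 = O(1 + q Delta^2) =
    O(1), while the CUSUM process at k* is of order n |Delta| up to an error
    O_P(sqrt n); since n Delta^2 tends to infinity, T_n does too. *)

(** * Window sums and Bartlett weights *)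

Lemma bartlett_sum (R : comNzRingType) (G : nat -> R) (m : nat) :
  \sum_(a < m) \sum_(b < m) G (maxn a b - minn a b)%N =
  m%:R * G 0%N + 2 * \sum_(1 <= j < m) (m%:R - j%:R) * G j.
Proof.
elim: m => [|m IH]; first by rewrite big_ord0 big_geq// mul0r mulr0 addr0.
(* The induction borders the square of pairs by one row and one column; each contributes the lags 1
   to m once, and the new corner contributes lag 0. *)
have row : \sum_(a < m) G (m - a)%N = \sum_(1 <= j < m.+1) G j.
  rewrite big_add1 /= big_mkord (reindex_inj rev_ord_inj) /=.
  by apply: eq_bigr => i _; congr G; have := ltn_ord i; lia.
(* Every weight grows by one; the new lag j = m enters with old weight m - m = 0. *)
have -> : \sum_(1 <= j < m.+1) (m.+1%:R - j%:R) * G j =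
    \sum_(1 <= j < m) (m%:R - j%:R) * G j + \sum_(1 <= j < m.+1) G j.
  transitivity (\sum_(1 <= j < m.+1) (m%:R - j%:R) * G j
     + \sum_(1 <= j < m.+1) G j).
    by rewrite -big_split /=; apply: eq_bigr => j _; rewrite -natr1; ring.
  congr +%R; case: m {IH row} => [|m]; first by rewrite !big_geq.
  by rewrite [LHS]big_nat_recr //= subrr mul0r addr0.
rewrite big_ord_recr /= [in X in _ + X]big_ord_recr /=.
under eq_bigr do rewrite big_ord_recr /=.
rewrite big_split /= IH maxnn minnn subnn -row.
have -> : \sum_(i < m) G (maxn i m - minn i m)%N = \sum_(i < m) G (m - i)%N.
  by apply: eq_bigr => i _; congr G; have := ltn_ord i; lia.
have -> : \sum_(i < m) G (maxn m i - minn m i)%N = \sum_(i < m) G (m - i)%N.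
  by apply: eq_bigr => i _; congr G; have := ltn_ord i; lia.
by rewrite -natr1; ring.
Qed.

(* Truncated subtraction is harmless: [z 0 = 0] absorbs the indices [e < a]. *)
Lemma sum_lag_shift (R : comNzRingType) (n q : nat) (z : nat -> R) (a b : nat) :
  z 0%N = 0 -> (forall i, (n < i)%N -> z i = 0) -> (a <= q)%N -> (b <= q)%N ->
  \sum_(e < n + q.+1) z (e - a)%N * z (e - b)%N =
  \sum_(i < n.+1) z i * z (i + (maxn a b - minn a b))%N.
Proof.
move=> z0 zn; wlog ab : a b / (a <= b)%N => [H aq bq|aq bq].
  have [ab|ba] := orP (leq_total a b); first exact: H.
  by rewrite maxnC minnC -H//; apply: eq_bigr => e _; rewrite mulrC.
rewrite -(big_mkord xpredT (fun e => z (e - a)%N * z (e - b)%N)).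
(* With [a <= b], terms with e < b contain [z 0], and after shifting by b those with index beyond n
   vanish by padding. *)
rewrite (@big_cat_nat _ _ _ b)//=; last by lia.
rewrite big_nat big1 ?add0r; last first.
  by move=> e eb; rewrite (_ : (e - b = 0)%N) ?z0 ?mulr0//; lia.
rewrite -{1}(add0n b) big_addn (@big_cat_nat _ _ _ n.+1)//=; last by lia.
rewrite [X in _ + X]big_nat [X in _ + X]big1 ?addr0; last first.
  by move=> e eb; rewrite (_ : (e + b - b = e)%N) ?(zn e) ?mulr0//; lia.
rewrite big_mkord; apply: eq_bigr => i _; rewrite addnK mulrC; congr (_ * z _).
by lia.
Qed.

(** Expand the squares and sum over the window end e first: offsets a, b leave the lag product sum
    at |a - b|, and [bartlett_sum] counts the pairs. The range of e covers every window meeting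
    1..n. *)
Lemma sum_window_sqr (R : comNzRingType) (n q : nat) (z : nat -> R) :
  z 0%N = 0 -> (forall i, (n < i)%N -> z i = 0) ->
  \sum_(e < n + q.+1) (\sum_(a < q.+1) z (e - a)%N) ^+ 2 =
  q.+1%:R * (\sum_(i < n.+1) z i * z i)
  + 2 * \sum_(1 <= j < q.+1) (q.+1%:R - j%:R) * \sum_(i < n.+1) z i * z (i + j)%N.
Proof.
move=> z0 zn.
have E0 : \sum_(i < n.+1) z i * z i = \sum_(i < n.+1) z i * z (i + 0)%N.
  by apply: eq_bigr => i _; rewrite addn0.
rewrite E0 -(bartlett_sum _ (fun j => \sum_(i < n.+1) z i * z (i + j)%N)).
under eq_bigr do rewrite expr2 big_distrlr /=.
rewrite exchange_big /=; apply: eq_bigr => a _.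
rewrite exchange_big /=; apply: eq_bigr => b _.
by apply: sum_lag_shift => //; rewrite -ltnS.
Qed.

(** * The variance estimator as a sum of squares *)

Section LongRunVariance.
Context {R : realType}.
Implicit Types (x : nat -> R) (n q : nat).

Definition centred n x i : R := if (0 < i <= n)%N then x i - Xbar n x else 0.

Lemma gammahat_centred n x j :
  gammahat n x j = n%:R^-1 * \sum_(i < n.+1) centred n x i * centred n x (i + j)%N.
Proof.
congr (_ * _).
rewrite -(big_mkord xpredT (fun i => centred n x i * centred n x (i + j)%N)).
rewrite [in RHS](@big_cat_nat _ _ _ (n - j).+1) //=; last by lia.
rewrite [X in _ = _ + X]big_nat [X in _ = _ + X]big1 ?addr0; last first.
  by move=> i ?; rewrite {2}/centred ifF ?mulr0//; lia.
rewrite [in RHS]big_nat_recl//= {1}/centred /= mul0r add0r big_add1 /=.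
rewrite big_nat [RHS]big_nat; apply: eq_bigr => i ?.
by rewrite /centred !ifT//; lia.
Qed.

(** The weight 1 - j/(q+1) equals (q+1-j)/(q+1), so clearing q+1 produces exactly the weights of
    [sum_window_sqr]. *)
Lemma s2_window n q x : s2 n q x = (n%:R * q.+1%:R)^-1 *
  \sum_(e < n + q.+1) (\sum_(a < q.+1) centred n x (e - a)%N) ^+ 2.
Proof.
rewrite sum_window_sqr ?/centred//=; last by move=> i ?; rewrite ifF//; lia.
have q0 : q.+1%:R != 0 :> R by rewrite pnatr_eq0.
have -> : s2 n q x = n%:R^-1 * (\sum_(i < n.+1) centred n x i * centred n x i)
    + 2 * \sum_(1 <= j < q.+1) bartlett q j * gammahat n x j.
  rewrite /s2 gammahat_centred; congr (_ * _ + _).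
  by apply: eq_bigr => i _; rewrite addn0.
have -> : \sum_(1 <= j < q.+1) bartlett q j * gammahat n x j =
    n%:R^-1 / q.+1%:R * \sum_(1 <= j < q.+1) (q.+1%:R - j%:R) *
       \sum_(i < n.+1) centred n x i * centred n x (i + j)%N.
  rewrite big_distrr /=; apply: eq_bigr => j _; rewrite gammahat_centred /bartlett.
  by set S := \sum_(_ < _) _; set u := n%:R^-1; move: (q.+1%:R) q0 => v v0; field.
rewrite invfM.
move: (\sum_(1 <= j < q.+1) _) (\sum_(i < n.+1) _) (n%:R^-1) q0 => S1 S2 u.
by move: (q.+1%:R) => v v0; field.
Qed.

Lemma s2_ge0 n q x : 0 <= s2 n q x.
Proof.
by rewrite s2_window mulr_ge0// sumr_ge0// => e _; exact: sqr_ge0.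
Qed.

Lemma cusum_centred n x k : (0 < n)%N -> (k <= n)%N ->
  cusum n x k = \sum_(1 <= i < k.+1) centred n x i.
Proof.
move=> n0 kn; transitivity (\sum_(1 <= i < k.+1) (x i - Xbar n x)); last first.
  by rewrite big_nat [RHS]big_nat; apply: eq_bigr => i ?; rewrite /centred ifT//; lia.
rewrite sumrB /cusum sumr_const_nat subSS subn0; congr (_ - _).
by rewrite /Xbar -[RHS]mulr_natl mulrA.
Qed.

(** Excludes the degenerate case: at s_n = 0 the inverse in [Tn] takes its default value 0, so a
    nonzero CUSUM has to force s_n > 0. *)
Lemma s2_eq0_cusum n q x k : (0 < n)%N -> (k <= n)%N ->
  s2 n q x = 0 -> cusum n x k = 0.
Proof.
move=> n0 kn /eqP; rewrite s2_window mulf_eq0 invr_eq0 mulf_eq0 !pnatr_eq0.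
rewrite (gtn_eqF n0) /= psumr_eq0; last by move=> *; exact: sqr_ge0.
move=> /allP H; rewrite cusum_centred// big_nat big1// => i /andP[_ ik].
have {ik kn} : (i < n + q.+1)%N by lia.
(* The window ending at i consists of entry i and entries of smaller index, already zero; its
   vanishing sum kills entry i. *)
elim/ltn_ind: i => i IH iN.
have := H (Ordinal iN) (mem_index_enum _) => /=.
rewrite sqrf_eq0 big_ord_recl /= subn0 big1 ?addr0 => [/eqP//|a _].
rewrite /bump /=; case: (posnP i) => [->|i0]; first by rewrite /centred.
by apply: IH; lia.
Qed.

End LongRunVariance.

(** The image of [h] lies in some [-N, N] and the other terms there are nonnegative. The Schur test
    uses this form, since each row of lags is an injective family. *)
Lemma abs_summable_inj (R : realType) (f : int -> R) : abs_summable_Z f ->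
  exists C : R, forall (I : finType) (h : I -> int), injective h ->
    \sum_i `|f (h i)| <= C.
Proof.
move=> [C fC]; exists C => I h hinj.
pose N := (\sum_i `|h i|)%N.
have hN i : (`|h i| <= N)%N by rewrite /N (bigD1 i)//= leq_addr.
pose g i : 'I_(2 * N).+1 := inord `|(h i + N%:Z)%R|%N.
have gE i : (g i)%:Z - N%:Z = h i.
  by rewrite /g inordK; have := hN i; lia.
have ginj : injective g by move=> i j gij; apply: hinj; rewrite -gE -(gE j) gij.
apply: le_trans (fC N).
have -> : \sum_i `|f (h i)| = \sum_(k in g @: [set: I]) `|f (k%:Z - N%:Z)|.
  rewrite big_imset /=; last by move=> i j _ _; exact: ginj.
  by apply: eq_big => [i|i _]; rewrite ?in_setT ?gE.
rewrite [leRHS](bigID (mem (g @: [set: I]))) /= lerDl.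
exact: sumr_ge0.
Qed.

(** * Second moments of linear forms in the noise *)

Section SecondMoments.
Context {R : realType} {d : measure_display} {T : measurableType d}.
Variables (P : probability T R) (Y : int -> T -> R).
Hypothesis Y4 : fourth_order_stationary P Y.
Hypothesis Y0 : forall k, Ex P (Y k) = 0%E.

Lemma measurable_linear_form (I : finType) (c : I -> R) (v : I -> int) :
  measurable_fun setT (fun w => \sum_i c i * Y (v i) w).
Proof.
apply: measurable_sum => i; apply: measurable_funM => //.
exact: Y4.1.
Qed.

Lemma integrable_prod2 i j : P.-integrable setT (fun w => (Y i w * Y j w)%:E).
Proof.
have [mY [iY _]] := Y4.
(* Dominating function: |xy| <= (x^2 + y^2)/2 and x^2 <= (x^4 + 1)/2 give |xy| <= x^4 + y^4 + 1. *)
have i1 : P.-integrable setT (fun w => (Y i w ^+ 4)%:E + ((Y j w ^+ 4)%:E + 1))%E.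
  apply: integrableD => //; apply: integrableD => //.
  exact: finite_measure_integrable_cst.
apply: le_integrable i1 => //.
  by apply/measurable_EFinP; exact: measurable_funM.
move=> w _; rewrite -!EFinD /= lee_fin.
have E x : (x : R) ^+ 4 = (`|x| ^+ 2) ^+ 2 by rewrite real_normK ?num_real// -exprM.
rewrite normrM [leRHS]ger0_norm !E ?addr_ge0 ?sqr_ge0//.
set a := `|_|; set b := `|_|.
have := sqr_ge0 (a - b); have := sqr_ge0 (a ^+ 2 - 1); have := sqr_ge0 (b ^+ 2 - 1).
nra.
Qed.

Lemma Ex_prod2 i j : Ex P (fun w => Y i w * Y j w) = (autocov P Y (j - i))%:E.
Proof.
rewrite /autocov !Y0 mulr0 subr0 fineK; last first.
  exact: integrable_fin_num (integrable_prod2 _ _).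
have [_ [_ sY]] := Y4.
have := sY [:: 0; j - i] i isT.
under [X in Ex P X]eq_fun do rewrite !big_cons big_nil mulr1 add0r subrK.
by under [X in _ = Ex P X]eq_fun do rewrite !big_cons big_nil mulr1.
Qed.

(** Schur test: |c_i c_j| <= (c_i^2 + c_j^2)/2 reduces the quadratic form to absolute row and column
    sums of the covariance matrix, each at most [C] because the lags in one row or column are
    distinct. *)
Lemma linear_form_sqr_le (C : R) (I : finType) (c : I -> R) (v : I -> int) :
  (forall (J : finType) (h : J -> int), injective h ->
     \sum_j `|autocov P Y (h j)| <= C) ->
  injective v ->
  (\int[P]_w ((\sum_i c i * Y (v i) w) ^+ 2)%:E <= (C * \sum_i c i ^+ 2)%:E)%E.
Proof.
move=> hC vinj.
have -> : (\int[P]_w ((\sum_i c i * Y (v i) w) ^+ 2)%:E)%E =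
    (\sum_(p : I * I) c p.1 * c p.2 * autocov P Y (v p.2 - v p.1))%:E.
  under eq_integral => w _.
    rewrite expr2 big_distrlr pair_bigA /= -sumEFin.
    under eq_bigr do rewrite mulrACA EFinM.
    over.
  rewrite integral_sum//; last first.
    by move=> p; apply: integrableZl => //; exact: integrable_prod2.
  rewrite -sumEFin; apply: eq_bigr => p _.
  by rewrite integralZl//; [rewrite [RHS]EFinM -Ex_prod2|exact: integrable_prod2].
rewrite lee_fin -(pair_bigA _ (fun i j => c i * c j * autocov P Y (v j - v i)))/=.
set A := fun i j => `|autocov P Y (v j - v i)|.
apply: (@le_trans _ _ (\sum_i \sum_j (c i ^+ 2 / 2 * A i j + c j ^+ 2 / 2 * A i j))).
  apply: ler_sum => i _; apply: ler_sum => j _; rewrite -mulrDl.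
  apply: le_trans (ler_norm _) _; rewrite normrM ler_wpM2r// normrM.
  have := sqr_ge0 (`|c i| - `|c j|).
  rewrite -(real_normK (num_real (c i))) -(real_normK (num_real (c j))); nra.
under [leLHS]eq_bigr do rewrite big_split/=.
rewrite big_split /= [X in _ + X]exchange_big /= mulr_sumr.
rewrite -big_split /=; apply: ler_sum => i _; rewrite -!mulr_sumr.
have h1 : \sum_j A i j <= C.
  by apply: (hC _ (fun j => v j - v i)) => j k /addIr /vinj.
have h2 : \sum_j A j i <= C.
  by apply: (hC _ (fun j => v i - v j)) => j k /addrI /oppr_inj /vinj.
have := sqr_ge0 (c i); nra.
Qed.
End SecondMoments.

(** * Deterministic bounds for signal, noise and statistic *)

Section Deterministic.
Context {R : realType}.
Implicit Types (x y g : nat -> R) (n q k : nat).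

Lemma XbarD n x y : Xbar n (fun i => x i + y i) = Xbar n x + Xbar n y.
Proof. by rewrite /Xbar big_split mulrDr. Qed.

Lemma centredD n x y i :
  centred n (fun i => x i + y i) i = centred n x i + centred n y i.
Proof. by rewrite /centred XbarD; case: ifP => _; rewrite ?addr0//; ring. Qed.

Lemma cusumD n x y k :
  cusum n (fun i => x i + y i) k = cusum n x k + cusum n y k.
Proof. by rewrite /cusum !big_split /=; ring. Qed.

(** Centring averages the differences [g i - g j] over j in 1..n, so only the oscillation of the
    signal matters. *)
Lemma norm_centred_le n g i (D : R) : (forall i j, `|g i - g j| <= D) ->
  `|centred n g i| <= D.
Proof.
move=> gD; have D0 : 0 <= D by apply: le_trans (gD 0%N 0%N).
rewrite /centred; case: ifP => [/andP[i0 iN]|_]; last by rewrite normr0.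
have n0 : (0 < n%:R :> R) by rewrite ltr0n; lia.
have -> : g i - Xbar n g = n%:R^-1 * \sum_(1 <= j < n.+1) (g i - g j).
  rewrite sumrB sumr_const_nat subSS subn0 mulrBr -[g i *+ n]mulr_natl mulKf//.
  by rewrite gt_eqF.
rewrite normrM (@ger0_norm _ n%:R^-1) ?invr_ge0// ler_pdivrMl//.
apply: le_trans (ler_norm_sum _ _ _) _.
rewrite mulr_natl; apply: le_trans (ler_sum _ (fun j _ => gD i j)) _.
by rewrite sumr_const_nat subSS subn0.
Qed.

Lemma s2_signal_noise_le n q y g (D : R) : (forall i j, `|g i - g j| <= D) ->
  s2 n q (fun i => g i + y i) <= 3 / (n%:R * q.+1%:R) *
    \sum_(e < n + q.+1)
      ((\sum_(a < q.+1) (0 < e - a <= n)%:R * y (e - a)%N) ^+ 2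
       + (q.+1%:R ^+ 2 * Xbar n y ^+ 2 + (q.+1%:R * D) ^+ 2)).
Proof.
move=> gD; have D0 : 0 <= D by apply: le_trans (gD 0%N 0%N).
rewrite s2_window -mulrA [leRHS]mulrCA ler_wpM2l ?invr_ge0// mulr_sumr.
apply: ler_sum => e _.
under eq_bigr do rewrite centredD.
rewrite big_split /=.
set u := \sum_(_ < _) centred n g _.
have hu : `|u| <= q.+1%:R * D.
  apply: le_trans (ler_norm_sum _ _ _) _.
  rewrite -[X in X%:R]card_ord mulr_natl -sumr_const.
  by apply: ler_sum => a _; exact: norm_centred_le.
set l := \sum_(_ < _) _ * _; set m := Xbar n y.
(* [t] counts the window positions inside 1..n; the centred noise over the window is the raw masked
   sum minus [t] times the mean. *)
set t := \sum_(a < q.+1) (0 < e - a <= n)%:R : R.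
have -> : \sum_(a < q.+1) centred n y (e - a) = l - t * m.
  rewrite /t mulr_suml -sumrB; apply: eq_bigr => a _.
  by rewrite /centred; case: ifP => _; rewrite ?mul1r// !mul0r subr0.
have t0 : 0 <= t by exact: sumr_ge0.
have tq : t <= q.+1%:R.
  rewrite -[X in X%:R]card_ord -sumr_const.
  by apply: ler_sum => a _; case: (_ && _).
have hu2 : u ^+ 2 <= (q.+1%:R * D) ^+ 2.
  by rewrite -(real_normK (num_real u)) lerXn2r// ?nnegrE ?mulr_ge0.
have ht2 : t ^+ 2 * m ^+ 2 <= q.+1%:R ^+ 2 * m ^+ 2.
  by rewrite ler_wpM2r ?sqr_ge0// lerXn2r// ?nnegrE.
(* These three squares add up to 3(u^2 + l^2 + (tm)^2) - (u + l - tm)^2, whence the factor 3. *)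
have := sqr_ge0 (u - l); have := sqr_ge0 (u + t * m); have := sqr_ge0 (l + t * m).
move: hu2 ht2; set Q := q.+1%:R; move: Q => Q; clearbody u l m t; clear.
nra.
Qed.

(** The mean of the observations, shaped so that [Xobs] unfolds to [step] plus noise. *)
Definition step (mu dl : R) (k i : nat) : R := mu + (if (i <= k)%N then 0 else dl).

Lemma norm_step_le mu dl k i j : `|step mu dl k i - step mu dl k j| <= `|dl|.
Proof.
rewrite /step; case: ifP; case: ifP => _ _; rewrite ?addr0.
- by rewrite subrr normr0.
- by rewrite opprD addrA subrr sub0r normrN.
- by rewrite addrC addKr.
- by rewrite subrr normr0.
Qed.

Lemma cusum_step mu dl n k : (0 < n)%N -> (k <= n)%N ->
  cusum n (step mu dl k) k = - (dl * (k%:R * (n%:R - k%:R) / n%:R)).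
Proof.
move=> n0 kn; have nn0 : n%:R != 0 :> R by rewrite pnatr_eq0; lia.
have s1 : \sum_(1 <= i < k.+1) step mu dl k i = k%:R * mu.
  rewrite mulr_natl -[X in _ *+ X](subn1 k.+1) -sumr_const_nat.
  by rewrite big_nat [RHS]big_nat; apply: eq_bigr => i ?; rewrite /step ifT ?addr0//; lia.
have s2 : \sum_(k.+1 <= i < n.+1) step mu dl k i = (n%:R - k%:R) * (mu + dl).
  rewrite -natrB// mulr_natl -subSS -sumr_const_nat.
  by rewrite big_nat [RHS]big_nat; apply: eq_bigr => i ?; rewrite /step ifF//; lia.
rewrite /cusum (@big_cat_nat _ _ _ k.+1 1 n.+1)//= s1 s2.
by field.
Qed.

Lemma cusum_max_ge n x k : (0 < k <= n)%N -> `|cusum n x k| <= cusum_max n x.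
Proof.
move=> kn; rewrite /cusum_max; apply: (le_bigmax_seq _ k _ (fun i => `|cusum n x i|)) => //.
by rewrite mem_index_iota ltnS.
Qed.

(** One index suffices since the maximum dominates it. The strict inequality makes that CUSUM
    nonzero, hence [s2] positive and division legitimate. *)
Lemma lt_Tn n q x k (M A : R) : (0 < n)%N -> (0 < k <= n)%N -> s2 n q x <= A ->
  Num.sqrt n%:R * (`|M| * Num.sqrt A) < `|cusum n x k| -> M < Tn n q x.
Proof.
move=> n0 kn sA hk; have sn0 : 0 < Num.sqrt n%:R :> R by rewrite sqrtr_gt0 ltr0n.
have s0 : 0 < s2 n q x.
  rewrite lt0r s2_ge0 andbT; apply/eqP => /(s2_eq0_cusum _ _ _ k n0) c0.
  by move: hk; rewrite c0 ?normr0 ?ltNge ?mulr_ge0//; case/andP: kn.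
apply: le_lt_trans (ler_norm M) _; rewrite /Tn ltr_pdivlMl ?mulr_gt0 ?sqrtr_gt0 ?ltr0n//.
apply: lt_le_trans (cusum_max_ge n x k kn).
apply: le_lt_trans hk; rewrite -mulrA ler_wpM2l// mulrC ler_wpM2l//.
exact: ler_wsqrtr.
Qed.

End Deterministic.

(** * Measurability of the statistics, and Markov's inequality *)

Section Measurability.
Context {R : realType} {d : measure_display} {T : measurableType d}.
Variable X : T -> nat -> R.
Hypothesis mX : forall i, measurable_fun setT (fun w => X w i).

Lemma measurable_Xbar n : measurable_fun setT (fun w => Xbar n (X w)).
Proof. by apply: measurable_funM => //; exact: measurable_sum. Qed.

Lemma measurable_s2 n q : measurable_fun setT (fun w => s2 n q (X w)).
Proof.
have mg j : measurable_fun setT (fun w => gammahat n (X w) j).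
  apply: measurable_funM => //; apply: measurable_sum => i.
  by apply: measurable_funM; apply: measurable_funB => //; exact: measurable_Xbar.
apply: measurable_funD => //; apply: measurable_funM => //.
by apply: measurable_sum => j; exact: measurable_funM.
Qed.

Lemma measurable_cusum n k : measurable_fun setT (fun w => cusum n (X w) k).
Proof.
apply: measurable_funB; first exact: measurable_sum.
by apply: measurable_funM => //; exact: measurable_sum.
Qed.

Lemma measurable_cusum_max n : measurable_fun setT (fun w => cusum_max n (X w)).
Proof.
rewrite /cusum_max; elim: (index_iota 1 n.+1) => [|i s IH].
  by under eq_fun do rewrite big_nil; exact: measurable_cst.
under eq_fun do rewrite big_cons.
apply: measurable_maxr => //; apply: measurableT_comp => //.
exact: measurable_cusum.
Qed.

Lemma measurable_Tn n q : measurable_fun setT (fun w => Tn n q (X w)).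
Proof.
apply: measurable_funM; last exact: measurable_cusum_max.
(* [powR] is measurable, and agrees with square root and inverse on [0, +oo). *)
have -> : (fun w => (Num.sqrt n%:R * Num.sqrt (s2 n q (X w)))^-1) =
    (fun w => (Num.sqrt n%:R * s2 n q (X w) `^ 2^-1) `^ (-1)).
  apply/funext => w; rewrite powR12_sqrt ?s2_ge0// powR_inv1//.
apply: (measurableT_comp (measurable_powR _)); apply: measurable_funM => //.
exact: (measurableT_comp (measurable_powR _) (measurable_s2 _ _)).
Qed.

Lemma measurable_lt_Tn n q (M : R) : measurable [set w | M < Tn n q (X w)].
Proof.
rewrite -[X in measurable X]setTI.
rewrite (_ : [set w | _] = (fun w => Tn n q (X w)) @^-1` `]M, +oo[%classic).
  exact: measurable_Tn.
by apply/funext => w /=; rewrite in_itv /= andbT.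
Qed.

End Measurability.

Lemma markov_ge0 {R : realType} {d} {T : measurableType d} (P : probability T R)
    (f : T -> R) (A K : R) : 0 < A -> measurable_fun setT f -> (forall w, 0 <= f w) ->
  (\int[P]_w (f w)%:E <= K%:E)%E -> (P [set w | (A <= f w)%R] <= (K / A)%:E)%E.
Proof.
move=> A0 mf f0 fK.
have := @le_integral_comp_abse _ _ _ P setT measurableT (fun w => (f w)%:E) A id
  (@measurable_id _ _ _) (fun _ => id) (fun _ _ _ _ => id)
  (proj2 (measurable_EFinP _ _) mf) A0.
rewrite setTI => h; rewrite mulrC EFinM lee_pdivlMl//.
have -> : [set w | A <= f w] = [set w | (A%:E <= `|(f w)%:E|)%E].
  by apply/funext => w /=; rewrite lee_fin ger0_norm.
apply: le_trans h _; apply: le_trans fK; rewrite le_eqVlt; apply/orP; left.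
by apply/eqP; apply: eq_integral => w _; rewrite /= ger0_norm.
Qed.

(** * Moment bounds for the noise and for s_n^2 *)

Section MomentBounds.
Context {R : realType} {d : measure_display} {T : measurableType d}.
Variables (P : probability T R) (Y : int -> T -> R) (C : R).
Hypothesis Y4 : fourth_order_stationary P Y.
Hypothesis Y0 : forall k, Ex P (Y k) = 0%E.
Hypothesis hC : forall (J : finType) (h : J -> int), injective h ->
  \sum_j `|autocov P Y (h j)| <= C.

Lemma autocov_bound_ge0 : 0 <= C.
(* The empty family has sum 0. *)
Proof. by apply: le_trans (hC void (of_void _) _) => [|[]]; exact: sumr_ge0. Qed.

Let mY i : measurable_fun setT (Y i). Proof. exact: Y4.1. Qed.

Lemma integral_window_le n q e :
  (\int[P]_w ((\sum_(a < q.+1) (0 < e - a <= n)%:R * Y (e - a)%N w) ^+ 2)%:E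
     <= (C * q.+1%:R)%:E)%E.
Proof.
(* Integer subtraction replaces the truncated one to make the index injective in [a]; where they
   differ the indicator is 0. *)
under eq_integral => w _.
  under eq_bigr => a _.
    have -> : (0 < e - a <= n)%:R * Y (e - a)%N w =
              (0 < e - a <= n)%:R * Y (e%:Z - a%:Z) w.
      case: (boolP (0 < e - a <= n)%N) => [ea|_]; last by rewrite !mul0r.
      by congr (_ * Y _ w); lia.
    over.
  over.
have inj : injective (fun a : 'I_q.+1 => e%:Z - a%:Z).
  by move=> a b ab; apply: val_inj => /=; lia.
apply: le_trans (linear_form_sqr_le P Y Y4 Y0 C _ _ _ hC inj) _.
rewrite lee_fin ler_wpM2l ?autocov_bound_ge0//.
apply: (@le_trans _ _ (\sum_(a < q.+1) 1)); last by rewrite sumr_const card_ord.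
apply: ler_sum => a _.
by case: (_ && _); rewrite ?expr1n// expr0n.
Qed.

Lemma injective_succZ n : injective (fun i : 'I_n => (i.+1)%:Z).
Proof. by move=> i j [ij]; exact: val_inj. Qed.

Lemma integral_Xbar_le n : (0 < n)%N ->
  (\int[P]_w (Xbar n (fun i => Y i%:Z w) ^+ 2)%:E <= (C / n%:R)%:E)%E.
Proof.
move=> n0; under eq_integral => w _.
  rewrite /Xbar big_add1 big_mkord mulr_sumr.
  over.
apply: le_trans (linear_form_sqr_le P Y Y4 Y0 C _ _ _ hC (injective_succZ n)) _.
rewrite sumr_const card_ord lee_fin -[X in C * X]mulr_natl expr2.
by rewrite mulVKf// pnatr_eq0; lia.
Qed.

Lemma integral_cusum_le n k : (0 < n)%N -> (k <= n)%N ->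
  (\int[P]_w (cusum n (fun i => Y i%:Z w) k ^+ 2)%:E <= (C * n%:R)%:E)%E.
Proof.
move=> n0 kn; under eq_integral => w _.
  (* A linear form with coefficients in [-1, 1], so their squares sum to at most n. *)
  have -> : cusum n (fun i => Y i%:Z w) k =
      \sum_(i < n) ((i < k)%:R - k%:R / n%:R) * Y (i.+1)%:Z w.
    under eq_bigr do rewrite mulrBl.
    rewrite sumrB -mulr_sumr /cusum !big_add1 /= !big_mkord; congr (_ - _).
    rewrite (big_ord_widen n (fun i => Y i.+1 w) kn) big_mkcond.
    by apply: eq_bigr => i _; case: (_ < _)%N; rewrite ?mul1r ?mul0r.
  over.
apply: le_trans (linear_form_sqr_le P Y Y4 Y0 C _ _ _ hC (injective_succZ n)) _.
rewrite lee_fin ler_wpM2l ?autocov_bound_ge0//.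
apply: (@le_trans _ _ (\sum_(i < n) 1)); last by rewrite sumr_const card_ord.
apply: ler_sum => i _.
have k0 : 0 <= k%:R / n%:R :> R by rewrite divr_ge0.
have k1 : k%:R / n%:R <= 1 :> R by rewrite ler_pdivrMr ?ltr0n// mul1r ler_nat.
by move: (k%:R / n%:R) k0 k1 => t t0 t1; case: (_ < _)%N => /=; nra.
Qed.

(** Integrates [s2_signal_noise_le] window by window: a masked noise sum costs C(q+1), the mean
    C(q+1)^2/n, the signal (q+1)^2 D^2. *)
Lemma integral_s2_le n q (g : nat -> R) (D : R) :
  (forall i j, `|g i - g j| <= D) -> (q.+1 <= n)%N ->
  (\int[P]_w (s2 n q (fun i => g i + Y i%:Z w))%:E
    <= (12 * C + 6 * q.+1%:R * D ^+ 2)%:E)%E.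
Proof.
move=> gD qn; have C0 := autocov_bound_ge0.
pose F e w := (\sum_(a < q.+1) (0 < e - a <= n)%:R * Y (e - a)%N w) ^+ 2
  + (q.+1%:R ^+ 2 * Xbar n (fun i => Y i%:Z w) ^+ 2 + (q.+1%:R * D) ^+ 2).
have mX : measurable_fun setT (fun w => Xbar n (fun i => Y i%:Z w) ^+ 2).
  by apply: measurable_funX; apply: (measurable_Xbar (fun w i => Y i%:Z w)).
have ml e : measurable_fun setT
    (fun w => (\sum_(a < q.+1) (0 < e - a <= n)%:R * Y (e - a)%N w) ^+ 2).
  apply: measurable_funX.
  exact: (measurable_linear_form P Y Y4 _ _ (fun a : 'I_q.+1 => (e - a)%N%:Z)).
have mF e : measurable_fun setT (F e).
  rewrite /F; apply: measurable_funD; first exact: ml.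
  apply: measurable_funD; last exact: measurable_cst.
  by apply: measurable_funM; [exact: measurable_cst|exact: mX].
have G0 w : 0 <= q.+1%:R ^+ 2 * Xbar n (fun i => Y i%:Z w) ^+ 2.
  by apply: mulr_ge0; exact: sqr_ge0.
have F0 e w : 0 <= F e w.
  by apply: addr_ge0; [exact: sqr_ge0|apply: addr_ge0; [exact: G0|exact: sqr_ge0]].
have intF e : (\int[P]_w (F e w)%:E <=
    (C * q.+1%:R + (q.+1%:R ^+ 2 * (C / n%:R) + (q.+1%:R * D) ^+ 2))%:E)%E.
  under eq_integral do rewrite !EFinD.
  rewrite ge0_integralD//; last 4 first.
  - by move=> w _; rewrite lee_fin sqr_ge0.
  - exact/measurable_EFinP.
  - by move=> w _; rewrite -EFinD lee_fin addr_ge0 ?G0 ?sqr_ge0.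
  - apply: emeasurable_funD => //.
    by apply/measurable_EFinP; exact: measurable_funM.
  rewrite ge0_integralD//; last 3 first.
  - by move=> w _; rewrite lee_fin G0.
  - by apply/measurable_EFinP; exact: measurable_funM.
  - by move=> w _; rewrite lee_fin sqr_ge0.
  under [X in (_ + (X + _))%E]eq_integral do rewrite EFinM.
  rewrite ge0_integralZl_EFin//; last 2 first.
  - by move=> w _; rewrite lee_fin sqr_ge0.
  - exact/measurable_EFinP.
  rewrite integral_cst// [X in (((_ * D) ^+ 2)%:E * X)%E]probability_setT mule1.
  rewrite !EFinD [(_ ^+ 2 * (C / _))%:E]EFinM.
  apply: leeD; first exact: integral_window_le.
  apply: leeD => //; apply: lee_wpmul2l; first by rewrite lee_fin sqr_ge0.
  by apply: integral_Xbar_le; lia.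
apply: (@le_trans _ _
    (\int[P]_w (3 / (n%:R * q.+1%:R) * \sum_(e < n + q.+1) F e w)%:E)%E).
  apply: ge0_le_integral => //.
  - by move=> w _; rewrite lee_fin s2_ge0.
  - apply/measurable_EFinP; apply: (measurable_s2 (fun w i => g i + Y i%:Z w)) => i.
    exact: measurable_funD.
  - apply/measurable_EFinP; apply: measurable_funM => //.
    exact: measurable_sum.
  - by move=> w _; rewrite lee_fin; exact: s2_signal_noise_le.
under eq_integral do rewrite EFinM -sumEFin.
rewrite ge0_integralZl//; last 2 first.
- by apply: emeasurable_sum => e; exact/measurable_EFinP.
- by move=> w _; rewrite sumEFin lee_fin sumr_ge0.
rewrite ge0_integral_sum//; last 2 first.
- by move=> e; exact/measurable_EFinP.
- by move=> e w _; rewrite lee_fin.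
apply: (@le_trans _ _ ((3 / (n%:R * q.+1%:R))%:E * (\sum_(e < n + q.+1)
    (C * q.+1%:R + (q.+1%:R ^+ 2 * (C / n%:R) + (q.+1%:R * D) ^+ 2))%:E))%E).
  apply: lee_wpmul2l; first by rewrite lee_fin divr_ge0// mulr_ge0.
  exact: lee_sum.
rewrite sumEFin -EFinM lee_fin sumr_const card_ord -[X in _ * X <= _]mulr_natl natrD.
have n0 : 0 < n%:R :> R by rewrite ltr0n; lia.
have q0 : 0 < q.+1%:R :> R by rewrite ltr0n.
have qn' : q.+1%:R <= n%:R :> R by rewrite ler_nat.
move: (n%:R) (q.+1%:R) n0 q0 qn' => N Q N0 Q0 QN.
(* Bounding both ratios Q/N by 1 gives 3 * 2 * (2C + Q D^2), the stated constants. *)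
rewrite (_ : 3 / (N * Q) * _ = 3 * (1 + Q / N) * (C + Q / N * C + Q * D ^+ 2));
  last by field; rewrite !gt_eqF.
have t1 : Q / N <= 1 by rewrite ler_pdivrMr// mul1r.
have t0 : 0 <= Q / N by rewrite divr_ge0 ?ltW.
have := mulr_ge0 (ltW Q0) (sqr_ge0 D).
rewrite -[6 * Q * _]mulrA.
move: (Q / N) (Q * D ^+ 2) t0 t1 => t E t0 t1 E0.
have : t * C <= C by rewrite ler_piMl.
have : 0 <= t * C by rewrite mulr_ge0.
move: (t * C) => tC tC0 tC1.
have -> : 12 * C + 6 * E = 6 * (2 * C + E) by ring.
apply: (@le_trans _ _ (6 * (C + tC + E))); last by rewrite ler_pM2l//; lra.
by rewrite ler_wpM2r//; lra.
Qed.

End MomentBounds.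

(** * Probability bound at a fixed sample size *)

Section LowerBound.
Context {R : realType} {d : measure_display} {T : measurableType d}.
Variables (P : probability T R) (Y : int -> T -> R) (C : R).
Hypothesis Y4 : fourth_order_stationary P Y.
Hypothesis Y0 : forall k, Ex P (Y k) = 0%E.
Hypothesis hC : forall (J : finType) (h : J -> int), injective h ->
  \sum_j `|autocov P Y (h j)| <= C.

(** Markov's inequality bounds the two bad events, s_n^2 >= A and squared noise CUSUM >= Bn. Off
    them the signal at k, at least c n |dl|, beats the noise and still leaves more than M s_n sqrt
    n. *)
Lemma probability_lt_Tn_ge n q k (mu dl c M A B : R) :
  0 < A -> 0 < B -> (q.+1 <= n)%N -> (0 < k <= n)%N ->
  c * n%:R <= k%:R * (n%:R - k%:R) / n%:R ->
  `|M| * Num.sqrt A + Num.sqrt B <= c * (Num.sqrt n%:R * `|dl|) ->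
  ((1 - ((12 * C + 6 * q.+1%:R * dl ^+ 2) / A + C / B))%:E
    <= P [set w | (M < Tn n q (fun i => step mu dl k i + Y i%:Z w))%R])%E.
Proof.
move=> A0 B0 qn kn ck hL.
have n0 : (0 < n)%N by lia.
have nR0 : 0 < n%:R :> R by rewrite ltr0n.
have mY i : measurable_fun setT (fun w => Y i%:Z w) by exact: Y4.1.
have mX i : measurable_fun setT (fun w => step mu dl k i + Y i%:Z w).
  exact: measurable_funD.
pose s w := s2 n q (fun i => step mu dl k i + Y i%:Z w).
pose u w := cusum n (fun i => Y i%:Z w) k.
have ms : measurable_fun setT s.
  exact: (measurable_s2 (fun w i => step mu dl k i + Y i%:Z w)).
have mu2 : measurable_fun setT (fun w => u w ^+ 2).
  by apply: measurable_funX; exact: (measurable_cusum (fun w i => Y i%:Z w)).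
have mge (f : T -> R) a : measurable_fun setT f -> measurable [set w | (a <= f w)%R].
  move=> mf; rewrite -[X in measurable X]setTI.
  rewrite (_ : [set w | _] = f @^-1` `[a, +oo[%classic); first exact: mf.
  by apply/funext => w /=; rewrite in_itv /= andbT.
have P1 : (P [set w | (A <= s w)%R] <= ((12 * C + 6 * q.+1%:R * dl ^+ 2) / A)%:E)%E.
  apply: markov_ge0 => //; first by move=> w; exact: s2_ge0.
  rewrite -(real_normK (num_real dl)); apply: (integral_s2_le P Y C Y4 Y0 hC) => //.
  by move=> i j; exact: norm_step_le.
have P2 : (P [set w | (B * n%:R <= u w ^+ 2)%R] <= (C / B)%:E)%E.
  rewrite (_ : C / B = C * n%:R / (B * n%:R)); last by field; rewrite !gt_eqF.
  apply: markov_ge0 => //; first by rewrite mulr_gt0.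
    by move=> w; exact: sqr_ge0.
  by apply: (integral_cusum_le P Y C Y4 Y0 hC) => //; case/andP: kn.
set E := [set w | (A <= s w)%R] `|` [set w | (B * n%:R <= u w ^+ 2)%R].
have mE : measurable E by apply: measurableU; exact: mge.
have PE : (P E <= ((12 * C + 6 * q.+1%:R * dl ^+ 2) / A + C / B)%:E)%E.
  rewrite EFinD; apply: le_trans (measureU2 _ _ _) (leeD P1 P2); exact: mge.
have sub : ~` E `<=` [set w | M < Tn n q (fun i => step mu dl k i + Y i%:Z w)].
  move=> w /= /not_orP[/negP]; rewrite -ltNge => sA /negP; rewrite -ltNge => uB.
  apply: (lt_Tn n q _ k M A n0 kn (ltW sA)).
  rewrite cusumD cusum_step//; last by case/andP: kn.
  have uB' : `|cusum n (fun i => Y i%:Z w) k| < Num.sqrt n%:R * Num.sqrt B.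
    by rewrite -sqrtrM// mulrC -sqrtr_sqr ltr_sqrt// mulr_gt0.
  (* Reverse triangle inequality: signal minus noise at k. *)
  apply: lt_le_trans (lerB_normD _ _); rewrite normrN ltrBrDr normrM.
  apply: (@lt_le_trans _ _ (Num.sqrt n%:R * (`|M| * Num.sqrt A + Num.sqrt B))).
    by rewrite mulrDr ltrD2l.
  apply: (@le_trans _ _ (`|dl| * (c * n%:R))); last first.
    by rewrite ler_wpM2l// (le_trans ck)// ler_norm.
  have -> : `|dl| * (c * n%:R) = Num.sqrt n%:R * (c * (Num.sqrt n%:R * `|dl|)).
    by rewrite -[X in c * X](sqr_sqrtr (ltW nR0)); ring.
  by rewrite ler_wpM2l.
have mT : measurable [set w | M < Tn n q (fun i => step mu dl k i + Y i%:Z w)].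
  exact: (measurable_lt_Tn (fun w i => step mu dl k i + Y i%:Z w)).
apply: le_trans (le_measure P _ _ sub); rewrite ?inE//; last exact: measurableC.
by rewrite [leRHS]probability_setC// EFinB leeB.
Qed.

End LowerBound.

(** * Passage to the limit *)

Lemma kstar_bounds (R : realType) (theta : R) (n : nat) :
  0 < theta < 1 -> 2 / theta <= n%:R ->
  (0 < kstar theta n <= n)%N /\
  theta * (1 - theta) / 2 * n%:R <=
    (kstar theta n)%:R * (n%:R - (kstar theta n)%:R) / n%:R.
Proof.
move=> /andP[t0 t1]; rewrite ler_pdivrMr// => tn; rewrite /kstar.
have n0 : 0 < n%:R :> R by nra.
have /andP[kl kr] := truncn_itv (mulr_ge0 (ltW n0) (ltW t0)).
move: kl kr; set k := Num.truncn _ => kl kr; rewrite -natr1 in kr.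
have kn : (k <= n)%N by rewrite -(ler_nat R); nra.
have k0 : (0 < k)%N by rewrite -(ltr_nat R); lra.
split; first by rewrite k0.
rewrite ler_pdivlMr//.
(* Compare factorwise: k > n theta - 1 >= n theta / 2 because n theta >= 2, and n - k >= n - n
   theta. *)
have -> : theta * (1 - theta) / 2 * n%:R * n%:R =
  (theta * n%:R / 2) * (n%:R - n%:R * theta) by field.
by apply: ler_pM; nra.
Qed.

(** Probabilities never exceed 1, so lower bounds suffice; measurability supplies finiteness. *)
Lemma cvg_probability1 (R : realType) (d : measure_display) (T : measurableType d)
    (P : probability T R) (A : nat -> set T) :
  (forall n, measurable (A n)) ->
  (forall e : R, 0 < e -> \forall n \near \oo, ((1 - e)%:E <= P (A n))%E) ->
  (fun n => P (A n)) @ \oo --> 1%E.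
Proof.
move=> mA hA; apply/fine_cvgP; split.
  by apply: nearW => n; exact: fin_num_measure.
apply/cvgrPdist_le => e e0; near=> n => /=.
have PA1 : (P (A n) <= 1)%E by exact: probability_le1.
have PAe : ((1 - e)%:E <= P (A n))%E by near: n; exact: hA.
rewrite -(fineK (fin_num_measure P _ (mA n))) !lee_fin in PA1 PAe.
by rewrite ger0_norm; lra.
Unshelve. all: by end_near.
Qed.

Theorem theorem3p2 (R : realType) (d : measure_display) (T : measurableType d)
  (P : probability T R) (Y : int -> T -> R) (mu theta : R) (Delta : nat -> R)
  (q : nat -> nat) :
  fourth_order_stationary P Y ->
  (forall k, Ex P (Y k) = 0%E) ->
  (exists sigma : R, 0 < sigma /\ FCLT P Y sigma) ->
  abs_summable_Z (autocov P Y) ->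
  cum4_summable P Y ->
  0 < theta < 1 ->
  (fun n : nat => n%:R * Delta n ^+ 2) @ \oo --> +oo ->
  (forall e : R, 0 < e -> exists M : R, \forall n \near \oo,
     (P [set w | (M < Delta n ^+ 2 *
        `|(khat n (Xobs mu theta Delta Y n w))%:R - (kstar theta n)%:R|)%R]
      < e%:E)%E) ->
  (exists C : R, forall n, `|(q n)%:R * Delta n ^+ 2| <= C) ->
  (forall n, (0 < q n)%N) ->
  (fun n : nat => ((q n)%:R : R)) @ \oo --> +oo ->
  (fun n : nat => ((q n)%:R / n%:R : R)) @ \oo --> 0 ->
  forall M : R,
    (fun n => P [set w | M < Tn n (q n) (Xobs mu theta Delta Y n w)]) @ \oo --> 1%E.
Proof.
move=> hY hE _ hsum _ th hn _ [C2 hC2] q0 _ hqn M.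
have [C hC] := abs_summable_inj _ _ hsum.
have C0 := autocov_bound_ge0 P Y C hC.
apply: cvg_probability1 => [n|e e0].
  apply: (measurable_lt_Tn (fun w => Xobs mu theta Delta Y n w)) => i.
  by apply: measurable_funD => //; exact: hY.1.
(* Since q >= 1, (q+1) Delta^2 <= 2q Delta^2 <= 2 C2, so [K] bounds E s_n^2; the 1 keeps it
   positive. [A] and [B] then make each Markov term at most e/2. *)
pose K := 12 * C + 12 * C2 + 1.
have C20 : 0 <= C2 by apply: le_trans (hC2 0%N).
have K0 : 0 < K by rewrite /K; lra.
pose A := 2 * K / e; pose B := 2 * (C + 1) / e.
have A0 : 0 < A by rewrite divr_gt0// mulr_gt0.
have B0 : 0 < B by rewrite divr_gt0// mulr_gt0//; lra.
pose c := theta * (1 - theta) / 2.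
have c0 : 0 < c by move: th => /andP[t0 t1]; rewrite divr_gt0// mulr_gt0// subr_gt0.
(* The level that sqrt n |Delta| must reach; n Delta^2 eventually exceeds its square. *)
pose L := (`|M| * Num.sqrt A + Num.sqrt B) / c.
have L0 : 0 <= L by rewrite divr_ge0 ?ltW// ltr_wpDl ?mulr_ge0 ?sqrtr_gt0.
near=> n.
have nth : 2 / theta <= n%:R by near: n; exact: nbhs_infty_ger.
have n1 : 2 <= n%:R :> R by near: n; exact: nbhs_infty_ger.
have nD : L ^+ 2 < n%:R * Delta n ^+ 2.
  by near: n; move/cvgryPgt : hn; exact.
have qn : (q n)%:R / n%:R < 2^-1 :> R.
  near: n; move/cvgr0Pnorm_lt : hqn => /(_ 2^-1); rewrite invr_gt0 => /(_ (ltr0Sn _ _)).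
  by apply: filterS => n; exact/le_lt_trans/ler_norm.
have nR0 : 0 < n%:R :> R by lra.
(* From 2q < n and q >= 1. *)
have qn1 : ((q n).+1 <= n)%N.
  move: qn; rewrite ltr_pdivrMr// => qn.
  have : (2 * q n < n)%N by rewrite -(ltr_nat R) natrM; lra.
  by move: (q0 n); clear; lia.
have [kn ck] := kstar_bounds _ _ _ th nth.
apply: le_trans (probability_lt_Tn_ge P Y C hY hE hC n (q n) (kstar theta n)
  mu (Delta n) c M A B A0 B0 qn1 kn ck _); last first.
  rewrite -ler_pdivrMl// mulrC -/L.
  rewrite -sqrtr_sqr -sqrtrM// -(ger0_norm L0) -sqrtr_sqr ler_wsqrtr//.
  exact: ltW.
rewrite lee_fin lerB//.
have h1 : (12 * C + 6 * (q n).+1%:R * Delta n ^+ 2) / A <= e / 2.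
  rewrite ler_pdivrMr// /A (_ : e / 2 * (2 * K / e) = K); last by field; rewrite gt_eqF.
  have QD := le_trans (ler_norm _) (hC2 n).
  have DQ : Delta n ^+ 2 <= (q n)%:R * Delta n ^+ 2.
    by rewrite ler_peMl ?sqr_ge0// ler1n.
  rewrite /K -[(q n).+1%:R]natr1; move: (Delta n ^+ 2) ((q n)%:R) QD DQ => D Q; lra.
have h2 : C / B <= e / 2.
  rewrite ler_pdivrMr// /B (_ : e / 2 * (2 * (C + 1) / e) = C + 1); last by field; rewrite gt_eqF.
  by rewrite lerDl.
by rewrite (le_trans (lerD h1 h2))// -splitr.
Unshelve. all: by end_near.
Qed.
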